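(* Let $f\in\mathcal T$. Then $$\operatorname{Re}\frac{f(\gamma+iy_1)}{f(\gamma+iy_2)}\ \ge\ 1,\qquad \gamma\in(-\infty,1],\quad 0<y_1\le y_2 .$$ This relation does not hold, in general, for $\gamma>1$.
   Context: Let $\Lambda:=\mathbb C\setminus[1,\infty)$. $\mathcal T$ denotes the set of all functions $f:\Lambda\to\mathbb C$ of the form $$f(z)=\int_0^1\frac{d\mu(t)}{1-tz},\qquad z\in\Lambda,$$ where $\mu$ is a Borel probability measure on $[0,1]$. Equivalently, these are the generating functions $\sum_{k\ge0}a_kz^k$ of Hausdorff moment sequences $a_k=\int_0^1t^k\,d\mu(t)$, extended analytically from the unit disk to $\Lambda$. Here $\gamma,y_1,y_2$ are real. *)

(* Defs.v *)
From HB Require Import structures.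
From mathcomp Require Import all_boot all_order all_algebra.
From mathcomp Require Import all_classical all_reals all_analysis.
From mathcomp Require Export complex.
Set Implicit Arguments.
Unset Strict Implicit.
Unset Printing Implicit Defensive.
Import Order.TTheory GRing.Theory Num.Theory.
Import numFieldNormedType.Exports.

Local Open Scope classical_set_scope.
Local Open Scope ring_scope.
Local Open Scope complex_scope.

Definition slit_plane (R : realType) : set R[i] :=
  ~` [set x%:C | x in `[1, +oo[%classic].
Arguments slit_plane R : clear implicits.

(* Integral of a complex-valued function, taken componentwise; [Rintegral] is
   the real-valued Lebesgue integral. *)
Definition Cintegral (d : measure_display) (T : measurableType d)
    (R : realType) (mu : {measure set T -> \bar R}) (D : set T)
    (g : T -> R[i]) : R[i] :=
  Rintegral mu D (fun t => complex.Re (g t)) +i*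
  Rintegral mu D (fun t => complex.Im (g t)).

(* The class T of functions on the slit plane, as total functions whose values
   off the slit plane are unconstrained.  A Borel probability measure on [0, 1]
   is a Borel probability measure on the line that gives [0, 1] mass 1. *)
Definition hausdorff_class (R : realType) : set (R[i] -> R[i]) :=
  [set f | exists2 mu : probability (measurableTypeR R) R,
     mu `[0, 1]%classic = 1%E &
     forall z : R[i], slit_plane R z ->
       f z = Cintegral mu `[0, 1]%classic (fun t : R => (1 - t%:C * z)^-1)].
Arguments hausdorff_class R : clear implicits.

(* Main.v *)
(* Write f(x + i y) as an integral of 1 / (a - i t y) with a = 1 - t x, which is
   nonnegative on [0, 1] exactly when x <= 1. Then
   Re (f(z1) conj f(z2)) - |f(z2)|^2 is a double integral over (s, t), and its
   symmetrized integrand turns out to be pointwise nonnegative as soon as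
   a, b >= 0 and y1 <= y2; so one integration in s followed by one in t suffices.
   For x > 1 the signs of a and b can differ, at s = 0 and t = 1, and the measure
   with two equal atoms at 0 and 1 violates the inequality for y1 = x - 1 and
   y2 = x. *)

Require Import Defs.
From HB Require Import structures.
From mathcomp Require Import all_boot all_order all_algebra.
From mathcomp Require Import all_classical all_reals all_analysis.
From mathcomp Require Import measurable_realfun ring lra.
Import Order.TTheory GRing.Theory Num.Theory.
Import numFieldNormedType.Exports.
Local Open Scope classical_set_scope.
Local Open Scope ring_scope.
Local Open Scope complex_scope.

(** * Real and imaginary parts of the kernel 1 / (1 - t z), z = x + i y *)

Definition stieltjes_re {R : realType} (x y t : R) : R :=
  (1 - t * x) / ((1 - t * x) ^+ 2 + (t * y) ^+ 2).

Definition stieltjes_im {R : realType} (x y t : R) : R :=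
  t * y / ((1 - t * x) ^+ 2 + (t * y) ^+ 2).

Lemma stieltjes_kernelE {R : realType} (x y t : R) :
  (1 - t%:C * (x +i* y))^-1 = stieltjes_re x y t +i* stieltjes_im x y t.
Proof.
rewrite /stieltjes_re /stieltjes_im; simpc.
by rewrite [LHS]/(invc _) /invc sqrrN mulNr opprK.
Qed.

Lemma stieltjes_denom_gt0 {R : realType} (x y t : R) : y != 0 ->
  0 < (1 - t * x) ^+ 2 + (t * y) ^+ 2.
Proof.
move=> y0; have [->|t0] := eqVneq t 0; first by rewrite !mul0r; lra.
by rewrite ltr_wpDl ?sqr_ge0// exprn_even_gt0//= mulf_neq0.
Qed.

Lemma continuous_stieltjes {R : realType} (x y : R) : y != 0 ->
  continuous (stieltjes_re x y) /\ continuous (stieltjes_im x y).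
Proof.
move=> y0.
have cD : continuous (fun t : R => ((1 - t * x) ^+ 2 + (t * y) ^+ 2)^-1).
  move=> t.
  apply: (@cvgV R R (nbhs t) _ (fun t => (1 - t * x) ^+ 2 + (t * y) ^+ 2)).
    by rewrite gt_eqF ?stieltjes_denom_gt0.
  have ct (k : R) : {for t, continuous (fun t : R => t * k)}.
    by apply: cvgMl; exact: cvg_id.
  have c1 : {for t, continuous (fun t : R => 1 - t * x)}.
    by apply: cvgB; [exact: cvg_cst | exact: ct].
  by apply: cvgD; [exact: (cvgM c1 c1) | exact: (cvgM (ct y) (ct y))].
split=> t; apply: cvgM; do ?exact: cD.
- by apply: cvgB; [exact: cvg_cst | apply: cvgMl; exact: cvg_id].
- by apply: cvgMl; exact: cvg_id.
Qed.

(** * Integration over [0, 1] and positivity of the symmetrized form *)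

Lemma continuous_integrable_unit {R : realType}
    (mu : probability (measurableTypeR R) R) (g : R -> R) :
  continuous g -> mu.-integrable `[0, 1]%classic (EFin \o g).
Proof.
move=> cg; apply: measurable_bounded_integrable => //.
- by rewrite (le_lt_trans (probability_le1 _ _))// ltry.
- by apply: measurable_funTS; exact: continuous_measurable_fun.
- have /compact_bounded[M [_ mrt]] : compact (g @` `[0, 1]%classic).
    apply: continuous_compact; last exact: segment_compact.
    exact: continuous_subspaceT.
  exists M; split; rewrite ?num_real// => N MN t t01.
  by apply: mrt => //; exists t.
Qed.

(** Linearity replaces Fubini here: with t fixed, integrating in s turns the symmetrized integrand
    into a linear combination of p, q, u, v at t, and integrating that in t gives twice the form. *)
Lemma Rintegral_form_ge0 {d} {T : measurableType d} {R : realType}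
    (mu : {measure set T -> \bar R}) (D : set T) (p q u v : T -> R) :
  measurable D ->
  mu.-integrable D (EFin \o p) -> mu.-integrable D (EFin \o q) ->
  mu.-integrable D (EFin \o u) -> mu.-integrable D (EFin \o v) ->
  (forall s t, D s -> D t ->
    0 <= (p s * u t + q s * v t) + (p t * u s + q t * v s)) ->
  0 <= Rintegral mu D p * Rintegral mu D u
     + Rintegral mu D q * Rintegral mu D v.
Proof.
move=> mD ip iq iu iv pos.
have iZ (f : T -> R) k : mu.-integrable D (EFin \o f) ->
    mu.-integrable D (EFin \o (fun s => f s * k)).
  move=> intf.
  have -> : EFin \o (fun s => f s * k) = fun s => ((f s)%:E * k%:E)%E.
    by apply/funext.
  exact: integrableZr.
have iD (f g : T -> R) : mu.-integrable D (EFin \o f) ->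
    mu.-integrable D (EFin \o g) ->
    mu.-integrable D (EFin \o (fun s => f s + g s)).
  move=> intf intg.
  have -> : EFin \o (fun s => f s + g s) = ((EFin \o f) \+ (EFin \o g))%E.
    by apply/funext.
  exact: integrableD.
(* Used twice: first with the values at a fixed t as coefficients, then with the four integrals
   themselves. *)
have lin (a b c e : R) :
    Rintegral mu D (fun s => (p s * a + q s * b) + (u s * c + v s * e)) =
    (Rintegral mu D p * a + Rintegral mu D q * b)
    + (Rintegral mu D u * c + Rintegral mu D v * e).
  rewrite !RintegralD ?RintegralZr//; do ?[exact: iZ | apply: iD => //].
set P := Rintegral mu D p; set U := Rintegral mu D u.
set Q := Rintegral mu D q; set V := Rintegral mu D v.
have half t : D t -> 0 <= (p t * U + q t * V) + (u t * P + v t * Q).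
  move=> Dt.
  rewrite addrC mulrC [v t * Q]mulrC [p t * U]mulrC [q t * V]mulrC -lin.
  apply: Rintegral_ge0 => s Ds.
  by rewrite ![u s * _]mulrC ![v s * _]mulrC; exact: pos.
have : 0 <= Rintegral mu D
    (fun t => (p t * U + q t * V) + (u t * P + v t * Q)).
  exact: Rintegral_ge0.
rewrite lin -/P -/Q -/U -/V; lra.
Qed.

(** With a = 1 - s x and b = 1 - t x this is the symmetrized integrand of Re((f(z1) - f(z2)) conj
    f(z2)). *)
Lemma stieltjes_form_ge0 {R : realFieldType} (a b s t y1 y2 : R) :
  0 <= a -> 0 <= b -> 0 <= s -> 0 <= t -> 0 < y1 -> y1 <= y2 ->
  0 < a ^+ 2 + (s * y1) ^+ 2 -> 0 < a ^+ 2 + (s * y2) ^+ 2 ->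
  0 < b ^+ 2 + (t * y1) ^+ 2 -> 0 < b ^+ 2 + (t * y2) ^+ 2 ->
  0 <= ((a / (a ^+ 2 + (s * y1) ^+ 2) - a / (a ^+ 2 + (s * y2) ^+ 2))
          * (b / (b ^+ 2 + (t * y2) ^+ 2))
        + (s * y1 / (a ^+ 2 + (s * y1) ^+ 2) - s * y2 / (a ^+ 2 + (s * y2) ^+ 2))
          * (t * y2 / (b ^+ 2 + (t * y2) ^+ 2)))
     + ((b / (b ^+ 2 + (t * y1) ^+ 2) - b / (b ^+ 2 + (t * y2) ^+ 2))
          * (a / (a ^+ 2 + (s * y2) ^+ 2))
        + (t * y1 / (b ^+ 2 + (t * y1) ^+ 2) - t * y2 / (b ^+ 2 + (t * y2) ^+ 2))
          * (s * y2 / (a ^+ 2 + (s * y2) ^+ 2))).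
Proof.
move=> a0 b0 s0 t0 y10 y12 ds1 ds2 dt1 dt2.
have z1 := ltW y10; have z2 := le_trans z1 y12.
have d0 : 0 <= y2 - y1 by rewrite subr_ge0.
(* N is the numerator over the common denominator, divided by y2 - y1; the only
   negative contribution, - s t (s b - t a)^2 y1^2 y2, is absorbed using y1 <= y2. *)
pose N := a * b * (s ^+ 2 * b ^+ 2 + t ^+ 2 * a ^+ 2) * y1
  + a * b * (s * b - t * a) ^+ 2 * y2
  + s * t * (t ^+ 2 * a ^+ 2 + s ^+ 2 * b ^+ 2) * (y1 * y2 * (y2 - y1))
  + 2 * (a * b * s ^+ 2 * t ^+ 2) * (y1 ^+ 2 * (y1 + y2))
  + 2 * (s ^+ 3 * t ^+ 3) * (y1 ^+ 3 * y2 ^+ 2).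
rewrite [leRHS](_ : _ =
  (y2 - y1) * N / ((a ^+ 2 + (s * y1) ^+ 2) * (a ^+ 2 + (s * y2) ^+ 2)
    * ((b ^+ 2 + (t * y1) ^+ 2) * (b ^+ 2 + (t * y2) ^+ 2)))); last first.
  by rewrite /N; field; rewrite !gt_eqF.
apply: divr_ge0; last first.
  by apply: mulr_ge0; apply: mulr_ge0; exact: ltW.
apply: mulr_ge0 => //; rewrite /N.
have y12_ge0 : 0 <= y1 + y2 by exact: addr_ge0.
have q1 : 0 <= s ^+ 2 * b ^+ 2 + t ^+ 2 * a ^+ 2.
  by rewrite addr_ge0// mulr_ge0// sqr_ge0.
have q2 := q1; rewrite addrC in q2.
(* The square becomes an atom because its base has no fixed sign; all other factors are visibly
   nonnegative. *)
move: ((s * b - t * a) ^+ 2) (sqr_ge0 (s * b - t * a)) => q q0.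
by rewrite !addr_ge0// !mulr_ge0.
Qed.

(** * Values of f off the real axis *)

Lemma Cintegral_stieltjes {R : realType}
    (mu : {measure set (measurableTypeR R) -> \bar R}) (D : set R) (x y : R) :
  Cintegral mu D (fun t : R => (1 - t%:C * (x +i* y))^-1) =
  Rintegral mu D (stieltjes_re x y) +i* Rintegral mu D (stieltjes_im x y).
Proof.
by rewrite /Cintegral; congr Complex; apply: eq_Rintegral => t _;
  rewrite stieltjes_kernelE.
Qed.

Lemma slit_plane_Im_neq0 {R : realType} (x y : R) :
  y != 0 -> slit_plane R (x +i* y).
Proof. by move=> y0 [u _ [_ uy]]; rewrite -uy eqxx in y0. Qed.

Lemma Re_divc {R : realType} (a b c e : R) :
  complex.Re ((a +i* b) / (c +i* e)) = (a * c + b * e) / (c ^+ 2 + e ^+ 2).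
Proof.
rewrite [(c +i* e)^-1]/(invc _) /invc; simpc => /=.
by rewrite !mulrA -mulrDl.
Qed.

(** This yields f(z) != 0. The sum is needed: a unit mass at 0 kills the imaginary part, and a unit
    mass at 1 kills the real part when x = 1. With a = 1 - t x and b = t y nonnegative, a^2 + b^2 <=
    (a + b)^2 bounds the integrand below by 1 / (a + b), hence by a positive constant. *)
Lemma Rintegral_stieltjes_gt0 {R : realType}
    (mu : probability (measurableTypeR R) R) (x y : R) :
  mu `[0, 1]%classic = 1%E -> x <= 1 -> 0 < y ->
  0 < Rintegral mu `[0, 1]%classic (stieltjes_re x y)
    + Rintegral mu `[0, 1]%classic (stieltjes_im x y).
Proof.
move=> mu1 x1 y0.
have [cre cim] := continuous_stieltjes x y (lt0r_neq0 y0).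
have ire := continuous_integrable_unit mu _ cre.
have iim := continuous_integrable_unit mu _ cim.
have k0 : 0 < 1 + `|x| + y by rewrite ltr_wpDl// addr_ge0.
rewrite -RintegralD//.
apply: (@lt_le_trans _ _ (Rintegral mu `[0, 1]%classic (cst (1 + `|x| + y)^-1))).
  by rewrite Rintegral_cst// [X in fine X]mu1 /= mulr1 invr_gt0.
apply: le_Rintegral => //.
- exact: finite_measure_integrable_cst.
- apply: continuous_integrable_unit => t.
  by apply: cvgD; [exact: cre | exact: cim].
move=> t; rewrite /= in_itv/= => /andP[t0 t1].
rewrite /stieltjes_re /stieltjes_im -mulrDl ler_pdivlMr; last first.
  by rewrite stieltjes_denom_gt0// gt_eqF.
rewrite mulrC ler_pdivrMr//.
have a0 : 0 <= 1 - t * x by nra.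
have xl : - x <= `|x| by rewrite -normrN ler_norm.
have n0 : 0 <= `|x| by [].
have le : 1 - t * x + t * y <= 1 + `|x| + y by nra.
have ty0 : 0 <= t * y by rewrite mulr_ge0// ltW.
nra.
Qed.

(** * The measure for the counterexample *)

Section two_point.
Context {R : realType}.
Local Open Scope ereal_scope.

Definition two_point : set (measurableTypeR R) -> \bar R :=
  mscale (2^-1)%:nng%R (measure_add \d_(0%R : measurableTypeR R)
                                \d_(1%R : measurableTypeR R)).

HB.instance Definition _ := Measure.on two_point.

(** A general set A serves both the whole line, for the total mass, and [0, 1], for the support
    condition. *)
Lemma two_point_mem01 (A : set (measurableTypeR R)) :
  A 0%R -> A 1%R -> two_point A = 1.
Proof.
move=> A0 A1.
rewrite /two_point /mscale [X in _ * X]measure_addE/= !diracE !mem_set//=.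
by rewrite -EFinD -EFinM; congr EFin; lra.
Qed.

HB.instance Definition _ := Measure_isProbability.Build _ _ _ two_point
  (two_point_mem01 setT I I).

Lemma Rintegral_two_point (g : R -> R) : continuous g ->
  Rintegral two_point `[0%R, 1%R]%classic g = ((g 0 + g 1) / 2)%R.
Proof.
move=> cg.
pose D : set (measurableTypeR R) := `[0%R, 1%R]%classic.
have D0 : D 0%R by rewrite /D /= in_itv/= lexx ler01.
have D1 : D 1%R by rewrite /D /= in_itv/= lexx ler01.
have mD : measurable D by exact: measurable_itv.
have mg : measurable_fun D g.
  by apply: measurable_funTS; exact: continuous_measurable_fun.
(* [ge0_integral_mscale] needs a nonnegative integrand, hence the detour
   through positive and negative parts. *)
have ge0 (h : measurableTypeR R -> \bar R) : measurable_fun D h ->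
    (forall t, 0 <= h t) ->
    \int[two_point]_(t in D) h t = (2^-1)%:E * (h 0%R + h 1%R).
  move=> mh h0.
  rewrite ge0_integral_mscale// ge0_integral_measure_add// !integral_dirac//.
  by rewrite !diracE !mem_set// !mul1e.
have mG : measurable_fun D (EFin \o g) by exact/measurable_EFinP.
rewrite -/D /Rintegral integralE !ge0//; last 2 first.
- exact: measurable_funeneg.
- exact: measurable_funepos.
have posneg (r : R) : (Num.max r 0 - Num.max (- r) 0 = r)%R.
  by rewrite /Num.max; do 2 case: ifPn => ?; lra.
rewrite !funeposE !funenegE /= -!EFin_max /=.
move: (posneg (g 0%R)) (posneg (g 1%R)).
lra.
Qed.

End two_point.

Theorem theorem1p1 (R : realType) :
  (forall f : R[i] -> R[i], hausdorff_class R f ->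
     forall gamma y1 y2 : R, gamma <= 1 -> 0 < y1 -> y1 <= y2 ->
       1 <= complex.Re (f (gamma +i* y1) / f (gamma +i* y2))) /\
  (forall gamma : R, 1 < gamma ->
     exists f : R[i] -> R[i], hausdorff_class R f /\
       exists y1 y2 : R, [/\ 0 < y1, y1 <= y2 &
         ~ (1 <= complex.Re (f (gamma +i* y1) / f (gamma +i* y2)))]).
Proof.
split=> [f [mu mu1 fE] x y1 y2 x1 y10 y12|x x1].
  have y20 : 0 < y2 := lt_le_trans y10 y12.
  have [n1 n2] := (lt0r_neq0 y10, lt0r_neq0 y20).
  rewrite !fE ?Cintegral_stieltjes ?Re_divc; try exact: slit_plane_Im_neq0.
  have [cre1 cim1] := continuous_stieltjes x y1 n1.
  have [cre2 cim2] := continuous_stieltjes x y2 n2.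
  have ire1 := continuous_integrable_unit mu _ cre1.
  have iim1 := continuous_integrable_unit mu _ cim1.
  have ire2 := continuous_integrable_unit mu _ cre2.
  have iim2 := continuous_integrable_unit mu _ cim2.
  have pos := Rintegral_stieltjes_gt0 mu x y2 mu1 x1 y20.
  (* By 2 (a^2 + b^2) = (a + b)^2 + (a - b)^2. *)
  have sq_pos (a b : R) : 0 < a + b -> 0 < a ^+ 2 + b ^+ 2.
    move=> ab; have := exprn_gt0 2 ab; have := sqr_ge0 (a - b); lra.
  rewrite ler_pdivlMr; last exact: sq_pos.
  have form : 0 <=
      Rintegral mu `[0, 1]%classic
        (fun t => stieltjes_re x y1 t - stieltjes_re x y2 t)
      * Rintegral mu `[0, 1]%classic (stieltjes_re x y2)
      + Rintegral mu `[0, 1]%classic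
        (fun t => stieltjes_im x y1 t - stieltjes_im x y2 t)
      * Rintegral mu `[0, 1]%classic (stieltjes_im x y2).
    apply: Rintegral_form_ge0 => //.
    - apply: continuous_integrable_unit => t.
      by apply: cvgB; [exact: cre1 | exact: cre2].
    - apply: continuous_integrable_unit => t.
      by apply: cvgB; [exact: cim1 | exact: cim2].
    move=> s t; rewrite /= !in_itv/= => /andP[s0 s1] /andP[t0 t1].
    by apply: stieltjes_form_ge0 => //; rewrite ?stieltjes_denom_gt0//; nra.
  by move: form; rewrite !RintegralB//; lra.
exists (fun z => Cintegral two_point `[0, 1]%classic
  (fun t : R => (1 - t%:C * z)^-1)).
split; first by exists two_point => //; apply: two_point_mem01; rewrite /= in_itv/= lexx ler01.
have x0 : 0 < x by lra.
(* Here f(z) = (1 + 1 / (1 - z)) / 2, and y1 = x - 1 gives 1 - z1 = (1 - x) (1 + i), which keeps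
   f(z1) simple. *)
exists (x - 1), x; split; [lra|lra|].
rewrite !Cintegral_stieltjes Re_divc.
have x0' : x != 0 by rewrite gt_eqF.
have x1' : x - 1 != 0 by rewrite subr_eq0 gt_eqF.
have [cre1 cim1] := continuous_stieltjes x (x - 1) x1'.
have [cre2 cim2] := continuous_stieltjes x x x0'.
rewrite !Rintegral_two_point//.
rewrite /stieltjes_re /stieltjes_im !mul0r !mul1r !subr0 expr0n/= addr0 expr1n.
rewrite divr1 !add0r.
have := stieltjes_denom_gt0 x (x - 1) 1 x1'; have := stieltjes_denom_gt0 x x 1 x0'.
rewrite !mul1r => D2 D1; apply/negP; rewrite -ltNge ltr_pdivrMr; last first.
  by rewrite ltr_wpDl ?sqr_ge0// exprn_gt0// divr_gt0// divr_gt0.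
(* The gap |f(z2)|^2 - Re(f(z1) conj f(z2)) collapses to the reciprocal of 4 |1 - z2|^2. *)
rewrite mul1r -subr_gt0 [ltRHS](_ : _ = (4 * ((1 - x) ^+ 2 + x ^+ 2))^-1).
  by rewrite invr_gt0 mulr_gt0.
by field; rewrite !gt_eqF.
Qed.
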